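(* Let $X$ be a compactum and let $F\colon X\to 2^{X}$ be an upper semicontinuous function. Then $F$ is dense minimal if and only if $F$ is weak dense minimal.
   Context: A compactum is a compact metric space. $2^X$ denotes the family of all nonempty closed subsets of $X$; $\mathbb N=\{1,2,3,\ldots\}$. A function $F\colon X\to 2^X$ is upper semicontinuous if for each $x\in X$ and every open $V\subseteq X$ with $F(x)\subseteq V$, there is an open $U\subseteq X$ with $x\in U$ and $F(y)\subseteq V$ for all $y\in U$. For $A\subseteq X$, $F(A)=\bigcup\{F(x):x\in A\}$; $F^1=F$ and $F^{n+1}(x)=F(F^n(x))$ for $x\in X$, $n\in\mathbb N$. The orbit set of $p\in X$ is $\mathcal{O}_F(p)=\{(x_n)_{n\in\mathbb N}\in X^{\mathbb N} : x_1=p \text{ and } x_{n+1}\in F(x_n) \text{ for each } n\in\mathbb N\}$. A point $p\in X$ has a dense orbit if there exists $(x_n)_{n=1}^{\infty}\in\mathcal{O}_F(p)$ such that for every nonempty open subset $U$ of $X$ there exists $k\in\mathbb N$ with $x_k\in U$. A point $p\in X$ has a weak dense orbit if for each nonempty open subset $U$ of $X$ there exists $k\in\mathbb N$ such that $F^k(p)\cap U\neq\emptyset$. $F$ is dense minimal if each point of $X$ has a dense orbit; $F$ is weak dense minimal if each point of $X$ has a weak dense orbit. *)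

(* Defs.v *)
From mathcomp Require Import all_boot all_order all_algebra.
From mathcomp Require Import all_classical all_reals all_analysis.

Set Implicit Arguments.
Unset Strict Implicit.
Unset Printing Implicit Defensive.

Local Open Scope classical_set_scope.

(* The hyperspace 2^X of nonempty closed subsets of X. *)
Record hyperspace (X : topologicalType) := Hyperspace {
  hset :> set X;
  hset_nonempty : hset !=set0;
  hset_closed : closed hset
}.

Definition upper_semicontinuous (X : topologicalType) (F : X -> hyperspace X) :=
  forall (x : X) (V : set X), open V -> F x `<=` V ->
    exists U : set X, [/\ open U, U x & forall y, U y -> F y `<=` V].

Definition mv_image (X : topologicalType) (F : X -> hyperspace X) (A : set X) :
  set X := \bigcup_(x in A) F x.

(* F^n(x), extended to n = 0 by F^0(x) = {x}; only n > 0 is used below. *)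
Definition mv_iter (X : topologicalType) (F : X -> hyperspace X) (n : nat)
  (x : X) : set X := iter n (mv_image F) [set x].

Lemma mv_iter1 (X : topologicalType) (F : X -> hyperspace X) (x : X) :
  mv_iter F 1 x = F x.
Proof. by rewrite /mv_iter /mv_image /= bigcup_set1. Qed.

Lemma mv_iterS (X : topologicalType) (F : X -> hyperspace X) (n : nat) (x : X) :
  mv_iter F n.+1 x = mv_image F (mv_iter F n x).
Proof. by []. Qed.

(* Sequences are indexed from 0, so the starting point p is x 0. *)
Definition orbit_set (X : topologicalType) (F : X -> hyperspace X) (p : X) :
  set (nat -> X) := [set x | x 0 = p /\ forall n, hset (F (x n)) (x n.+1)].

Definition has_dense_orbit (X : topologicalType) (F : X -> hyperspace X)
  (p : X) :=
  exists2 x : nat -> X, orbit_set F p x &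
    forall U : set X, open U -> U !=set0 -> exists k, U (x k).

(* The iterates start at F^1, so p itself does not count as visited. *)
Definition has_weak_dense_orbit (X : topologicalType) (F : X -> hyperspace X)
  (p : X) :=
  forall U : set X, open U -> U !=set0 ->
    exists2 k, 0 < k & mv_iter F k p `&` U !=set0.

Definition dense_minimal (X : topologicalType) (F : X -> hyperspace X) :=
  forall p : X, has_dense_orbit F p.

Definition weak_dense_minimal (X : topologicalType) (F : X -> hyperspace X) :=
  forall p : X, has_weak_dense_orbit F p.

(* Main.v *)
Require Import Defs.
From HB Require Import structures.
From mathcomp Require Import all_boot all_order all_algebra.
From mathcomp Require Import all_classical all_reals all_analysis.

(** Fix a countable family of nonempty open sets such that every nonempty open
    set contains one of them. If every point has a weak dense orbit, then from
    every point a finite trajectory of positive length leads into any prescribed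
    member of the family; concatenating such trajectories, each started at the
    endpoint of the previous one, gives an orbit visiting all members. The
    converse is immediate except for an orbit that visits an open set only at
    time 0; then a dense orbit started at its next point is used instead. *)

Local Open Scope classical_set_scope.

(** Compactness and the metric yield a countable basis; its nonempty members suffice. *)
Lemma compact_countable_pi_base {R : realType} {X : metricType R} (p : X) :
  compact [set: X] ->
  exists V : nat -> set X, (forall n, open (V n) /\ V n !=set0) /\
    forall U : set X, open U -> U !=set0 -> exists n, V n `<=` U.
Proof.
(* [compact_second_countable] is only stated for pointed spaces. *)
pose Xp := HB.pack_for (pseudoPMetricType R) X (isPointed.Build X p).
move=> /(@compact_second_countable R Xp)[B cB [Bopen Bbasis]].
pose B' := B `&` [set A | A !=set0].
have sub (U : set X) : open U -> U !=set0 -> exists2 A, B' A & A `<=` U.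
  move=> Uo [x Ux]; have [A [BA Ax] AU] := Bbasis x U (open_nbhs_nbhs (conj Uo Ux)).
  by exists A => //; split => //; exists x.
have : countable B' by apply: sub_countable cB; apply: subset_card_le => A [].
(* A countable set is empty or an image of [nat]; [B'] is not empty, as [setT] contains [p]. *)
case/pfcard_geP => [B'0|[V]].
  by have [A] := sub setT openT (ex_intro _ p I); rewrite B'0.
exists V; split=> [n|U Uo U0].
  by have [/Bopen] := @funS _ _ _ _ V n I.
have [A B'A AU] := sub U Uo U0.
by have [n _ VnA] := @surj _ _ _ _ V A B'A; exists n; rewrite VnA.
Qed.

Section Concatenation.
Context {T : Type} (e : rel T) (V : nat -> set T) (s : T -> nat -> seq T).
Hypothesis s_neq_nil : forall q n, s q n <> [::].
Hypothesis s_path : forall q n, path e q (s q n).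
Hypothesis s_last : forall q n, V n (last q (s q n)).

(* A state is (current point, index of the next target, rest of the trajectory
   towards the current target). *)
Definition concat_step (z : T * nat * seq T) : T * nat * seq T :=
  match z with
  | (q, n, a :: l) => (a, n, l)
  | (q, n, [::]) => (head q (s q n), n.+1, behead (s q n))
  end.

Definition concat_point p k := (iter k concat_step (p, 0, [::])).1.1.

Lemma concat_point_edge p k : e (concat_point p k) (concat_point p k.+1).
Proof.
rewrite /concat_point iterS; set z := iter _ _ _.
(* Invariant: the pending trajectory is a path from the current point. *)
have zP : path e z.1.1 z.2.
  rewrite /z; elim: k {z} => //= k; case: (iter _ _ _) => [[q n] [_|a l]] /=.
    by have := s_path q n; case: (s q n) => //= a l /andP[].
  by case/andP.
case: z zP => [[q n] [_|a l]] /=; last by case/andP.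
(* Nonemptiness keeps [head q] from returning its default [q], which may have no edge to itself. *)
have := s_path q n; have := s_neq_nil q n.
by case: (s q n) => //= a l _ /andP[].
Qed.

Lemma iter_concat_step q n l :
  iter (size l) concat_step (q, n, l) = (last q l, n, [::]).
Proof. by elim: l q => //= a l IH q; rewrite -iterS iterSr /= IH. Qed.

Lemma concat_point_visits p n : exists k, V n (concat_point p k).
Proof.
(* Loading a trajectory already moves to its first point, so its size is the exact number of
   steps. *)
have next q m : iter (size (s q m)) concat_step (q, m, [::]) =
    (last q (s q m), m.+1, [::]).
  have := s_neq_nil q m; case E: (s q m) => [//|a l] _.
  by rewrite [size _]/= iterSr /= E /= iter_concat_step.
have reach m : exists k q, iter k concat_step (p, 0, [::]) = (q, m, [::]).
  elim: m => [|m [k [q kq]]]; first by exists 0, p.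
  by exists (size (s q m) + k), (last q (s q m)); rewrite iterD kq.
have [k [q kq]] := reach n; exists (size (s q n) + k).
by rewrite /concat_point iterD kq next; exact: s_last.
Qed.

End Concatenation.

Lemma mv_iter_path {X : topologicalType} (F : X -> hyperspace X) k p y :
  mv_iter F k p y ->
  exists s, [/\ size s = k, path (fun a b => `[< hset (F a) b >]) p s &
    last p s = y].
Proof.
elim: k y => [y ->|k IH y [z /IH[s [sk sp <-]] Fzy]]; first by exists [::].
exists (rcons s y); rewrite size_rcons sk rcons_path sp last_rcons.
by split => //; apply/asboolP.
Qed.

Lemma orbit_mv_iter {X : topologicalType} (F : X -> hyperspace X) p q x k :
  hset (F p) q -> orbit_set F q x -> mv_iter F k.+1 p (x k).
Proof.
move=> Fpq [x0 xS]; elim: k => [|k IH]; first by rewrite mv_iter1 x0.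
by rewrite mv_iterS; exists (x k).
Qed.

Theorem theorem5p5 (R : realType) (X : metricType R) (F : X -> hyperspace X)
    (hX : compact [set: X]) (hF : upper_semicontinuous F) :
  dense_minimal F <-> weak_dense_minimal F.
Proof.
split=> [dF p U Uo U0|wF p].
  have [q Fpq] := hset_nonempty (F p).
  have [x xq xd] := dF q; have [k Uxk] := xd U Uo U0.
  by exists k.+1 => //; exists (x k); split => //; exact: orbit_mv_iter Fpq xq.
have [V [VP Vsub]] := compact_countable_pi_base p hX.
pose e a b := `[< hset (F a) b >].
have /choice[s sP] : forall qn : X * nat, exists s : seq X,
    [/\ s <> [::], path e qn.1 s & V qn.2 (last qn.1 s)].
  move=> [q n]; have [Vo V0] := VP n.
  have [k k0 [y [/mv_iter_path[s [sk sp <-]] Vy]]] := wF q _ Vo V0.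
  (* The trajectory is nonempty because weak density provides [0 < k]. *)
  by exists s; split => // s0; move: k0; rewrite -sk s0.
pose s' q n := s (q, n).
exists (concat_point s' p).
  split=> // n; apply/asboolP; apply: (@concat_point_edge _ e s' _ _ p n) => q m.
    by have [] := sP (q, m).
  by have [] := sP (q, m).
move=> U Uo U0; have [n VU] := Vsub U Uo U0.
have [|q m|k Vk] := @concat_point_visits _ V s' _ _ p n.
- by move=> q m; have [] := sP (q, m).
- by have [] := sP (q, m).
by exists k; exact: VU.
Qed.
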